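(* Let $(A,X)$ be a primitive axial algebra (for some fusion law $\mathcal{F}\subseteq\mathbb{F}$ over a field $\mathbb{F}$) with a Frobenius form $(\cdot,\cdot)$ (which is allowed to be zero). Let $R(A)$ be the axial radical of $A$, $J(A)$ the Jacobson radical of $A$, and $A^\perp$ the radical of the form. Then $$R(A)\subseteq J(A)\subseteq A^\perp.$$
   Context: Algebras are not assumed associative or unital. A fusion law is a set $\mathcal{F}\subseteq\mathbb{F}$ ($\mathbb{F}$ a field, always $1\in\mathcal{F}$) with a map $\ast:\mathcal{F}\times\mathcal{F}\to 2^{\mathcal{F}}$. For a commutative $\mathbb{F}$-algebra $A$, $a\in A$ and $\lambda\in\mathbb{F}$ let $A_\lambda(a)=\{u\in A\mid au=\lambda u\}$, and for $\Lambda\subseteq\mathbb{F}$ let $A_\Lambda(a)=\bigoplus_{\lambda\in\Lambda}A_\lambda(a)$. A non-zero idempotent $a\in A$ is an axis for $\mathcal{F}$ if $A=A_{\mathcal{F}}(a)$ and $A_\lambda(a)A_\mu(a)\subseteq A_{\lambda\ast\mu}(a)$ for all $\lambda,\mu\in\mathcal{F}$; it is primitive if $A_1(a)=\mathbb{F}a$. A primitive axial algebra for $\mathcal{F}$ is a pair $(A,X)$ with $A$ a commutative $\mathbb{F}$-algebra and $X\subseteq A$ a set of primitive axes for $\mathcal{F}$ generating $A$ as an algebra. The axial radical $R(A)$ is the unique largest ideal of $A$ containing no element of $X$ (it is known to exist). The Jacobson radical $J(A)$ is the intersection of all maximal ideals of $A$ (maximal among proper ideals), with $J(A)=A$ if there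 are no maximal ideals. A Frobenius form on $A$ is a bilinear form $(\cdot,\cdot):A\times A\to\mathbb{F}$ with $(uv,w)=(u,vw)$ for all $u,v,w\in A$; the zero form is allowed. $A^\perp=\{u\in A\mid (u,v)=0\text{ for all }v\in A\}$. *)

(* Defs.v *)
From HB Require Import structures.
From mathcomp Require Import all_boot all_order all_algebra.
From mathcomp Require Import boolp classical_sets.

Set Implicit Arguments.
Unset Strict Implicit.
Unset Printing Implicit Defensive.

Import GRing.Theory.
Local Open Scope classical_set_scope.
Local Open Scope ring_scope.

(* The values of [fus_op] outside [fus_set] are never used. *)
Record fusion_law (F : fieldType) := FusionLaw {
  fus_set : set F;
  fus_op : F -> F -> set F;
  fus_one : fus_set 1;
  fus_op_sub : forall l m, fus_set l -> fus_set m -> fus_op l m `<=` fus_set }.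

(* A (nonassociative, nonunital) algebra over F is an F-module A together with
   a bilinear product [mul]; A may be infinite-dimensional. *)
Section AxialAlgebras.
Variables (F : fieldType) (A : lmodType F) (mul : {bilinear A -> A -> A}).
Implicit Types (a u v w : A) (I X : set A) (law : fusion_law F).

Definition eigenspace a (l : F) : set A := [set u | mul a u = l *: u].

(* Finite sums of eigenvectors for distinct eigenvalues in L; the sum of the
   eigenspaces is automatically direct. *)
Definition eigensum a (L : set F) : set A :=
  [set u | exists (s : seq F) (v : F -> A),
     [/\ uniq s,
         (forall l, l \in s -> L l /\ eigenspace a l (v l)) &
         u = \sum_(l <- s) v l]].

Definition axis law a : Prop :=
  [/\ a != 0,
      mul a a = a,
      eigensum a (fus_set law) = [set: A] &
      forall l m, fus_set law l -> fus_set law m ->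
        forall u v, eigenspace a l u -> eigenspace a m v ->
          eigensum a (fus_op law l m) (mul u v)].

Definition primitive_axis law a : Prop :=
  axis law a /\ eigenspace a 1 = [set c *: a | c in [set: F]].

Definition subspace I : Prop :=
  I 0 /\ (forall (c : F) u v, I u -> I v -> I (c *: u + v)).

Definition subalgebra I : Prop :=
  subspace I /\ (forall u v, I u -> I v -> I (mul u v)).

Definition primitive_axial_algebra law X : Prop :=
  [/\ commutative mul,
      (forall a, X a -> primitive_axis law a) &
      smallest subalgebra X = [set: A]].

Definition ideal I : Prop :=
  subspace I /\ (forall u v, I v -> I (mul u v) /\ I (mul v u)).

Definition largest (C : set (set A)) I : Prop :=
  C I /\ (forall I', C I' -> I' `<=` I).

Definition axis_free_ideal X : set (set A) :=
  [set I | ideal I /\ (forall a, X a -> ~ I a)].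

(* The default value [set: A] is never taken on a primitive axial algebra; see
   [axial_radicalP]. *)
Definition axial_radical X : set A :=
  xget [set: A] [set R | largest (axis_free_ideal X) R].

Definition maximal_ideal I : Prop :=
  [/\ ideal I, I <> [set: A] &
      forall I', ideal I' -> I' <> [set: A] -> I `<=` I' -> I' = I].

(* An empty intersection is [set: A]. *)
Definition jacobson_radical : set A :=
  \bigcap_(M in [set M | maximal_ideal M]) M.

Definition frobenius_form (B : {biscalar A}) : Prop :=
  forall u v w, B (mul u v) w = B u (mul v w).

Definition form_radical (B : {biscalar A}) : set A :=
  [set u | forall v, B u v = 0].

Section AxialRadical.
Variables (law : fusion_law F) (X : set A).
Hypothesis axX : primitive_axial_algebra law X.

Let adsub a l u : A := mul a u - l *: u.
Let adsubs a (s : seq F) u : A := foldr (adsub a) u s.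

Let adsubsD a s : {morph adsubs a s : u v / u + v}.
Proof.
move=> u v; elim: s => //= l s ->.
by rewrite /adsub linearDr scalerDr opprD addrACA.
Qed.

Let adsubs0 a s : adsubs a s 0 = 0.
Proof.
by elim: s => //= l s ->; rewrite /adsub linear0r scaler0 subr0.
Qed.

Let adsubs_eigen a s m u :
  eigenspace a m u -> adsubs a s u = (\prod_(l <- s) (m - l)) *: u.
Proof.
rewrite /eigenspace /= => au; elim: s => [|l s IHs] /=.
  by rewrite big_nil scale1r.
rewrite IHs big_cons /adsub linearZr_LR au !scalerA -scalerBl.
by rewrite mulrBl [m * _]mulrC.
Qed.

Let adsubs_ideal a s I u : ideal I -> I u -> I (adsubs a s u).
Proof.
move=> [[_ lI] mI] Iu; elim: s => //= l s Is.
rewrite /adsub addrC -scaleNr; apply: lI => //.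
by have [] := mI a _ Is.
Qed.

Let adsubs_axis a s :
  a != 0 -> mul a a = a -> 1 \notin s ->
  exists2 d, d != 0 & forall c, adsubs a s (c *: a) = (d * c) *: a.
Proof.
move=> a0 aa s1; exists (\prod_(l <- s) (1 - l)).
  rewrite prodf_seq_neq0; apply/allP => l ls /=; rewrite subr_eq0.
  by apply: contraNneq s1 => ->.
move=> c; rewrite -scalerA; apply: adsubs_eigen.
by rewrite /eigenspace /= linearZr_LR aa scale1r.
Qed.

Let axis_decomp a u : X a ->
  exists c (s : seq F) (v : F -> A),
    [/\ 1 \notin s, forall l, l \in s -> eigenspace a l (v l) &
        u = c *: a + \sum_(l <- s) v l].
Proof.
move=> Xa; have [_ pX _] := axX; have [[_ _ Afull _] prim] := pX a Xa.
have : [set: A] u by [].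
rewrite -Afull => -[s [v [us sv ->]]].
have e1 l : l \in s -> eigenspace a l (v l) by case/sv.
have [s1|s1] := boolP (1 \in s); last first.
  by exists 0, s, v; split=> //; rewrite scale0r add0r.
have := e1 1 s1; rewrite prim => -[c _ ca].
exists c, (rem 1 s), v; split.
- by rewrite mem_rem_uniqF.
- by move=> l /mem_rem; exact: e1.
- by rewrite (perm_big _ (perm_to_rem s1)) big_cons ca.
Qed.

Let adsubs_sum a s (v : F -> A) : (forall l, l \in s -> eigenspace a l (v l)) ->
  adsubs a s (\sum_(l <- s) v l) = 0.
Proof.
move=> sv; rewrite (big_morph _ (adsubsD a s) (adsubs0 a s)) big1_seq // => l /= ls.
rewrite (adsubs_eigen s (sv l ls)); apply/eqP; rewrite scaler_eq0; apply/orP; left.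
by rewrite prodf_seq_eq0; apply/hasP; exists l; rewrite //= subrr.
Qed.

Let W a : set A := [set u | exists v, u = mul a v - v].

Let subspace_W a : subspace (W a).
Proof.
split=> [|c u v [x ->] [y ->]]; first by exists 0; rewrite linear0r subr0.
exists (c *: x + y).
by rewrite linearDr linearZr_LR scalerBr opprD addrACA.
Qed.

Let axis_notin_W a : X a -> ~ W a a.
Proof.
move=> Xa [u au]; have [_ pX _] := axX; have [[a0 aa _ _] _] := pX a Xa.
have [c [s [v [s1 sv ue]]]] := axis_decomp u Xa.
have [d d0 da] := adsubs_axis a0 aa s1.
suff ae : a = \sum_(l <- s) (l - 1) *: v l.
  have : adsubs a s a = 0.
    rewrite {2}ae (adsubs_sum (v := fun l => (l - 1) *: v l)) // => l ls.
    by rewrite /eigenspace /= linearZr_LR (sv l ls) !scalerA mulrC.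
  rewrite -{2}[a]scale1r da mulr1 => /eqP.
  by rewrite scaler_eq0 (negPf d0) (negPf a0).
rewrite {1}au ue linearDr linearZr_LR aa opprD addrACA subrr add0r.
rewrite linear_sumr -sumrB; apply: eq_big_seq => l ls.
by rewrite (sv l ls) scalerBl scale1r.
Qed.

Let axis_free_sub_W I a : X a -> ideal I -> ~ I a -> I `<=` W a.
Proof.
move=> Xa idI nIa u Iu; have [_ pX _] := axX; have [[a0 aa _ _] _] := pX a Xa.
have [c [s [v [s1 sv ue]]]] := axis_decomp u Xa.
have [d d0 da] := adsubs_axis a0 aa s1.
have c0 : c = 0.
  apply/eqP/negPn/negP => c0; apply: nIa.
  have := adsubs_ideal a s idI Iu.
  rewrite ue adsubsD adsubs_sum // addr0 da => Ida.
  have [[I0 lI] _] := idI.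
  have := lI (d * c)^-1 _ _ Ida I0.
  by rewrite addr0 scalerA mulVf ?scale1r // mulf_neq0.
exists (\sum_(l <- s) (l - 1)^-1 *: v l).
rewrite ue c0 scale0r add0r linear_sumr -sumrB; apply: eq_big_seq => l ls.
have l1 : l - 1 != 0 by rewrite subr_eq0; apply: contraNneq s1 => <-.
rewrite linearZr_LR (sv l ls) scalerA mulrC -scalerA -[X in _ - X]scale1r.
by rewrite -scalerBl scalerA mulfV ?scale1r.
Qed.

Let sum_ideals : set A :=
  smallest subspace (\bigcup_(I in axis_free_ideal X) I).

Let subspace_sum : subspace sum_ideals.
Proof.
split=> [I [[I0 _] _] //|c u v Su Sv I hI].
by have [[_ lI] _] := hI; apply: lI; [apply: Su | apply: Sv].
Qed.

Let sub_sum I : axis_free_ideal X I -> I `<=` sum_ideals.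
Proof. by move=> hI u Iu J [_ sJ]; apply: sJ; exists I. Qed.

Let ideal_sum : ideal sum_ideals.
Proof.
have [mulC _ _] := axX; split=> [|u v Sv]; first exact: subspace_sum.
suff Suv : sum_ideals (mul u v) by split=> //; rewrite mulC.
have [S0 lS] := subspace_sum.
apply: (Sv [set w | sum_ideals (mul u w)]); split.
  split=> [|c w1 w2 /= Sw1 Sw2]; first by rewrite /= linear0r.
  by rewrite linearDr linearZr_LR; apply: lS.
move=> w [I hI Iw]; have [[_ mI] _] := hI.
by apply: (sub_sum hI); have [] := mI u w Iw.
Qed.

Lemma axial_radicalP : largest (axis_free_ideal X) (axial_radical X).
Proof.
apply: (@xgetPex _ _ [set R | largest (axis_free_ideal X) R]).
exists sum_ideals; split; last by move=> I; exact: sub_sum.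
split=> [|a Xa Sa]; first exact: ideal_sum.
apply: (axis_notin_W Xa); apply: (Sa (W a)); split; first exact: subspace_W.
move=> u [I [idI nI] Iu]; apply: (axis_free_sub_W Xa idI _ Iu).
exact: nI.
Qed.

End AxialRadical.
End AxialAlgebras.

(* Main.v *)
(** For an axis [a] and a vector [u], a product of operators [ad a - l] with
    [l != 1] kills every component of [u] outside [F a]. Hence an ideal meeting
    the coset [a + A_{l != 1}(a)] contains [a]. In particular two ideals avoiding
    [a] have a sum avoiding [a]; since a maximal ideal misses some axis, it must
    absorb the axial radical.

    The same operators show that the form is symmetric and that for every ideal
    [I] each axis lies in [I] or in its orthogonal [I^perp], so that
    [I + I^perp = A]. If [(a, a) != 0], the orthogonal of the ideal generated by
    [a] is then a maximal ideal avoiding [a]. So every axis in [J(A)] is isotropic,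
    hence in the radical of the form; all axes thus lie in [J(A)^perp], that is
    [J(A)^perp = A]. *)

Require Import Defs.
From mathcomp Require Import all_boot all_order all_algebra.
From mathcomp Require Import boolp classical_sets.

Local Open Scope classical_set_scope.
Local Open Scope ring_scope.

Import GRing.Theory.

Section ShiftedAdjoint.
Set Implicit Arguments.
Unset Strict Implicit.
Context {F : fieldType} {A : lmodType F} (mul : {bilinear A -> A -> A}).
Implicit Types (a u v w : A) (s : seq F) (I : set A).

(** The polynomial with root list [s], evaluated at multiplication by [a] and applied to [u]. *)
Definition ad_shift a s u : A := foldr (fun l w => mul a w - l *: w) u s.

Lemma ad_shiftD a s : {morph ad_shift a s : u v / u + v}.
Proof.
move=> u v; elim: s => //= l s ->.
by rewrite linearDr scalerDr opprD addrACA.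
Qed.

Lemma ad_shift0 a s : ad_shift a s 0 = 0.
Proof. by elim: s => //= l s ->; rewrite linear0r scaler0 subr0. Qed.

Lemma ad_shift_eigen a s m u : Defs.eigenspace mul a m u ->
  ad_shift a s u = (\prod_(l <- s) (m - l)) *: u.
Proof.
rewrite /Defs.eigenspace /= => au; elim: s => [|l s IHs] /=.
  by rewrite big_nil scale1r.
rewrite IHs big_cons linearZr_LR au !scalerA -scalerBl.
by rewrite mulrBl [m * _]mulrC.
Qed.

Lemma ideal_add I u v : ideal mul I -> I u -> I v -> I (u + v).
Proof. by move=> [[_ lI] _] Iu Iv; rewrite -[u]scale1r; exact: lI. Qed.

Lemma ideal_scale I c u : ideal mul I -> I u -> I (c *: u).
Proof. by move=> [[I0 lI] _] Iu; rewrite -[c *: u]addr0; exact: lI. Qed.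

Lemma ideal_unscale {I c u} : ideal mul I -> c != 0 -> I (c *: u) -> I u.
Proof. by move=> idI c0 /(ideal_scale c^-1 idI); rewrite scalerA mulVf ?scale1r. Qed.

Lemma ad_shift_ideal a s I u : ideal mul I -> I u -> I (ad_shift a s u).
Proof.
move=> idI Iu; elim: s => //= l s Is.
rewrite -scaleNr; apply: ideal_add => //; last exact: ideal_scale.
by have [_ mI] := idI; have [] := mI a _ Is.
Qed.

Lemma prod_one_sub_neq0 s : 1 \notin s -> \prod_(l <- s) (1 - l) != 0.
Proof.
move=> s1; rewrite prodf_seq_neq0; apply/allP => l ls /=; rewrite subr_eq0.
by apply: contraNneq s1 => ->.
Qed.

(** Take for [s] the eigenvalues other than 1 occurring in [u]: each factor kills its own component,
    and by primitivity the 1-component is already a multiple of [a]. The scalar [c] may vanish. *)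
Lemma ad_shift_axis law a u : primitive_axis mul law a ->
  exists s c, 1 \notin s /\ ad_shift a s u = c *: a.
Proof.
move=> [[a0 aa Afull _] prim].
have : [set: A] u by [].
rewrite -Afull => -[s [v [_ sv ->]]].
exists [seq l <- s | l != 1].
suff [c cE] : exists c, ad_shift a [seq l <- s | l != 1] (\sum_(l <- s) v l) = c *: a.
  by exists c; rewrite mem_filter eqxx.
rewrite (big_morph _ (ad_shiftD a _) (ad_shift0 a _)) big_seq.
elim/big_ind: _ => [|_ _ [c ->] [d ->]|l ls].
- by exists 0; rewrite scale0r.
- by exists (c + d); rewrite scalerDl.
have [_ vl] := sv l ls; rewrite (ad_shift_eigen _ vl).
have [l1|l1] := eqVneq l 1.
  by move: vl; rewrite l1 prim => -[c _ <-]; rewrite scalerA; eexists.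
exists 0; rewrite scale0r; apply/eqP; rewrite scaler_eq0 prodf_seq_eq0.
by apply/orP; left; apply/hasP; exists l; rewrite ?mem_filter ?l1 //= subrr.
Qed.

(** If both scalars produced by the shifts vanished, the composite shift would kill [u + v = a], yet
    it multiplies [a] by a product of factors [1 - l] with [l != 1]. *)
Lemma ideal_sum_avoids_axis law a I I' u v : primitive_axis mul law a ->
  ideal mul I -> ideal mul I' -> I u -> I' v -> a = u + v -> I a \/ I' a.
Proof.
move=> pa idI idI' Iu Iv auv; have [[a0 aa _ _] _] := pa.
have ea : Defs.eigenspace mul a 1 a by rewrite /Defs.eigenspace /= scale1r.
have [s [c [s1 uE]]] := ad_shift_axis u pa.
(* The second shift is adapted to the image of [v] under the first, so the composite sends both
   summands into the line of [a]. *)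
have [t [d [t1 vE]]] := ad_shift_axis (ad_shift a s v) pa.
have Ica : I (c *: a) by rewrite -uE; exact: ad_shift_ideal.
have Ida : I' (d *: a) by rewrite -vE; apply: (ad_shift_ideal _ _ idI'); exact: ad_shift_ideal.
have [c0|c0] := eqVneq c 0; last by left; exact: ideal_unscale Ica.
have [d0|d0] := eqVneq d 0; last by right; exact: ideal_unscale Ida.
have : ad_shift a t (ad_shift a s a) = 0.
  by rewrite {3}auv !ad_shiftD vE d0 uE c0 !scale0r ad_shift0 addr0.
rewrite (ad_shift_eigen s ea) (ad_shift_eigen (m := 1) t); last first.
  by rewrite /Defs.eigenspace /= linearZr_LR aa scale1r.
move/eqP; rewrite scalerA scaler_eq0 (negPf a0) orbF mulf_eq0.
by rewrite (negPf (prod_one_sub_neq0 s1)) (negPf (prod_one_sub_neq0 t1)).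
Qed.

Lemma ideal_sum I I' : ideal mul I -> ideal mul I' ->
  ideal mul [set w | exists u v, [/\ I u, I' v & w = u + v]].
Proof.
move=> idI idI'; have [[I0 lI] mI] := idI; have [[I'0 lI'] mI'] := idI'.
split; first split.
- by exists 0, 0; rewrite addr0.
- move=> c _ _ [u1 [v1 [Iu1 Iv1 ->]]] [u2 [v2 [Iu2 Iv2 ->]]].
  exists (c *: u1 + u2), (c *: v1 + v2).
  by split; [exact: lI|exact: lI'|rewrite scalerDr addrACA].
- move=> w _ [u [v [Iu Iv ->]]].
  have [wu uw] := mI w u Iu; have [wv vw] := mI' w v Iv.
  split; [exists (mul w u), (mul w v)|exists (mul u w), (mul v w)];
    by split=> //; rewrite ?linearDr ?linearDl.
Qed.

Lemma bigcap_ideal (C : set (set A)) : C `<=` ideal mul ->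
  ideal mul (\bigcap_(I in C) I).
Proof.
move=> idC; split; first split.
- by move=> I /idC [[I0 _] _].
- by move=> c u v Cu Cv I CI; have [[_ lI] _] := idC I CI; apply: lI; [exact: Cu|exact: Cv].
- by move=> u v Cv; split=> I CI; have [_ mI] := idC I CI; have [] := mI u v (Cv I CI).
Qed.

End ShiftedAdjoint.

Section Radicals.
Set Implicit Arguments.
Unset Strict Implicit.
Context {F : fieldType} {A : lmodType F} {mul : {bilinear A -> A -> A}}.
Context {law : fusion_law F} {X : set A}.
Hypothesis axX : primitive_axial_algebra mul law X.
Implicit Types (a u v w : A) (I M : set A).

Lemma primitive_axisX {a} : X a -> primitive_axis mul law a.
Proof. by case: axX => _ pX _; exact: pX. Qed.

Lemma subalgebra_full I : subalgebra mul I -> X `<=` I -> I = [set: A].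
Proof.
move=> algI XI; have [_ _ gen] := axX.
by rewrite -subTset -gen => u Su; apply: Su.
Qed.

Lemma ideal_full I : ideal mul I -> X `<=` I -> I = [set: A].
Proof.
move=> [sI mI]; apply: subalgebra_full; split=> // u v _ Iv.
by have [] := mI u v Iv.
Qed.

Lemma ideal_misses_axis I : ideal mul I -> I <> [set: A] ->
  exists2 a, X a & ~ I a.
Proof.
move=> idI IT; apply: contrapT => nXI; apply: IT; apply: ideal_full => // a Xa.
by apply: contrapT => nIa; apply: nXI; exists a.
Qed.

Lemma axial_radical_sub_jacobson :
  axial_radical mul X `<=` jacobson_radical mul.
Proof.
have [[idR nR] _] := axial_radicalP axX.
move=> r Rr M [idM MT maxM].
have [a Xa nMa] := ideal_misses_axis idM MT.
(* This sum of the two ideals avoids [a], so it is proper; maximality then forces it to be [M]. *)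
pose S := [set w | exists u v, [/\ axial_radical mul X u, M v & w = u + v]].
have nSa : ~ S a.
  move=> [u [v [Ru Mv auv]]].
  by have [/(nR a Xa)|] := ideal_sum_avoids_axis (primitive_axisX Xa) idR idM Ru Mv auv.
have <- : S = M.
  apply: maxM; first exact: ideal_sum.
  - by move=> ST; apply: nSa; rewrite ST.
  - by move=> v Mv; exists 0, v; rewrite add0r; split=> //; case: idR => -[].
by exists r, 0; rewrite addr0; split=> //; case: idM => -[].
Qed.

Context {B : {biscalar A}}.
Hypothesis frobB : frobenius_form mul B.

Let mulC : commutative mul. Proof. by case: axX. Qed.

(** Paired with the idempotent [a], multiplication by [a] acts as the identity:
    [B (mul a u) a = B u (mul a a) = B u a]. The mirror version is needed because symmetry of the
    form is deduced from the two. *)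
Lemma form_ad_shiftl a s u : mul a a = a ->
  B (ad_shift mul a s u) a = (\prod_(l <- s) (1 - l)) * B u a.
Proof.
move=> aa; elim: s => [|l s IHs] /=; first by rewrite big_nil mul1r.
by rewrite big_cons linearBl linearZl_LR mulC frobB aa IHs -mulrA mulrBl mul1r.
Qed.

Lemma form_ad_shiftr a s u : mul a a = a ->
  B a (ad_shift mul a s u) = (\prod_(l <- s) (1 - l)) * B a u.
Proof.
move=> aa; elim: s => [|l s IHs] /=; first by rewrite big_nil mul1r.
by rewrite big_cons linearBr linearZr_LR -frobB aa IHs -mulrA mulrBl mul1r.
Qed.

(** The vectors that commute with all others under [B] form a subalgebra. It contains each axis [a],
    since a shift replaces the other argument by a multiple of [a] at the cost of a nonzero
    factor. *)
Lemma form_sym u v : B u v = B v u.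
Proof.
suff /seteqP[_ /(_ v Logic.I)/(_ u)] : [set w | forall u, B u w = B w u] = [set: A] by [].
apply: subalgebra_full; first split; first split.
- by move=> w; rewrite linear0r linear0l.
- by move=> c w x Sw Sx y; rewrite linearDr linearZr_LR linearDl linearZl_LR Sw Sx.
- by move=> w x Sw Sx y; rewrite -frobB Sx -frobB Sw -frobB.
- move=> a Xa w; have pa := primitive_axisX Xa; have [[a0 aa _ _] _] := pa.
  have [s [c [s1 wE]]] := ad_shift_axis w pa.
  apply: (mulfI (prod_one_sub_neq0 s1)).
  by rewrite -form_ad_shiftl // -form_ad_shiftr // wE linearZl_LR linearZr_LR.
Qed.

Definition orthogonal I : set A := [set v | forall u, I u -> B u v = 0].

Lemma orthogonal_ideal I : ideal mul I -> ideal mul (orthogonal I).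
Proof.
move=> [_ mI]; split; first split.
- by move=> u _; rewrite linear0r.
- by move=> c v w Ov Ow u Iu; rewrite linearDr linearZr_LR Ov // Ow // addr0; exact: mulr0.
- move=> w v Ov; suff Owv : orthogonal I (mul w v) by rewrite [mul v w]mulC.
  by move=> u Iu; rewrite -frobB; apply: Ov; have [] := mI w u Iu.
Qed.

(** A shift moves [u] in [I] to [c *: a] in [I]; if [a] is outside [I] then [c = 0], so a nonzero
    multiple of [B u a] vanishes. *)
Lemma axis_ideal_or_orthogonal I a : ideal mul I -> X a -> I a \/ orthogonal I a.
Proof.
move=> idI Xa; have [Ia|nIa] := pselect (I a); [by left|right => u Iu].
have pa := primitive_axisX Xa; have [[a0 aa _ _] _] := pa.
have [s [c [s1 uE]]] := ad_shift_axis u pa.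
have c0 : c = 0.
  apply/eqP/negPn/negP => c0; apply/nIa/(ideal_unscale idI c0).
  by rewrite -uE; exact: ad_shift_ideal.
apply: (mulfI (prod_one_sub_neq0 s1)).
by rewrite -form_ad_shiftl // uE c0 scale0r linear0l mulr0.
Qed.

Lemma isotropic_axis a u : X a -> B a a = 0 -> B u a = 0.
Proof.
move=> Xa Baa; have pa := primitive_axisX Xa; have [[a0 aa _ _] _] := pa.
have [s [c [s1 uE]]] := ad_shift_axis u pa.
apply: (mulfI (prod_one_sub_neq0 s1)).
by rewrite -form_ad_shiftl // uE linearZl_LR Baa [RHS]mulr0; exact: mulr0.
Qed.

Lemma jacobson_axis_isotropic a : X a -> jacobson_radical mul a -> B a a = 0.
Proof.
move=> Xa Ja; apply: contrapT => Baa.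
pose I := smallest (ideal mul) [set a].
have idI : ideal mul I by apply: bigcap_ideal => I' [].
have Ia : I a by move=> I' [_]; apply.
have subI I' : ideal mul I' -> I' a -> I `<=` I'.
  by move=> idI' I'a u Iu; apply: Iu; split=> // _ ->.
have nOa : ~ orthogonal I a by move=> /(_ a Ia).
apply: (nOa); apply: Ja; split; first exact: orthogonal_ideal.
  by move=> OT; apply: nOa; rewrite OT.
(* Were [a] in [M], then [M] would contain both [I] and its orthogonal, hence every axis. *)
move=> M idM MT OM; have nMa : ~ M a.
  move=> Ma; apply: MT; apply: ideal_full => // b Xb.
  have [|/OM //] := axis_ideal_or_orthogonal idI Xb.
  exact: subI.
(* By symmetry it suffices that [I] lies in the orthogonal of [M]. The latter is an ideal, and it
   contains [a] because [M] does not. *)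
apply/seteqP; split=> // u Mu w Iw; rewrite form_sym.
have [//|Oa] := axis_ideal_or_orthogonal idM Xa.
exact: (subI _ (orthogonal_ideal idM) Oa w Iw).
Qed.

Lemma jacobson_sub_form_radical : jacobson_radical mul `<=` form_radical B.
Proof.
have idJ : ideal mul (jacobson_radical mul).
  by apply: bigcap_ideal => M [].
have OT : orthogonal (jacobson_radical mul) = [set: A].
  apply: ideal_full; first exact: orthogonal_ideal.
  (* Only axes inside the Jacobson radical remain; being isotropic, they are orthogonal to all of
     [A]. *)
  move=> a Xa; have [Ja u _|//] := axis_ideal_or_orthogonal idJ Xa.
  by apply: isotropic_axis => //; exact: jacobson_axis_isotropic.
move=> u Ju v; have : [set: A] v by [].
by rewrite -OT; apply.
Qed.

End Radicals.

Theorem theorem1p1 (F : fieldType) (A : lmodType F)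
    (mul : {bilinear A -> A -> A}) (law : fusion_law F) (X : set A)
    (B : {biscalar A})
    (axX : primitive_axial_algebra mul law X) (frobB : frobenius_form mul B) :
  axial_radical mul X `<=` jacobson_radical mul /\
  jacobson_radical mul `<=` form_radical B.
Proof.
split; first exact: axial_radical_sub_jacobson axX.
exact: (jacobson_sub_form_radical axX frobB).
Qed.
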